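(* Let $\mathcal{K}$ be a local field whose valuation $|\cdot|$ takes the values $\{0\} \cup \{q^m : m \in \mathbb{Z}\}$. Let $\phi : \{0\} \cup \{q^m : m \in \mathbb{Z}\} \to \mathbb{R}$ be such that $\lim_{m \to \infty} \phi(q^{-m}) = \phi(0) = 1$. For $n \in \mathbb{N}$, define $\phi_n : \mathcal{K}^n \to \mathbb{R}$ by \[ \phi_n(x_1,\dots,x_n) := \phi(|x_1| \vee \cdots \vee |x_n|). \] Then $\phi_n$ is nonnegative definite for every $n \in \mathbb{N}$ if and only if $\phi$ is nonnegative and nonincreasing.
   Context: $\mathbb{N} = \{1,2,\dots\}$. A local field $\mathcal{K}$ is a locally compact, non-discrete topological field other than $\mathbb{R}$ or $\mathbb{C}$ (equivalently, for some prime $p$, a finite algebraic extension of the field of $p$-adic numbers or of the field of Laurent series over the finite field with $p$ elements). It carries its normalized non-Archimedean valuation $|\cdot|$, which satisfies $|x| = 0 \iff x = 0$, $|xy| = |x||y|$, $|x+y| \le |x| \vee |y|$, induces the topology of $\mathcal{K}$, and takes exactly the values $\{0\} \cup \{q^m : m \in \mathbb{Z}\}$, where $q = p^c$ for some prime $p$ and positive integer $c$; it is normalized so that, with $\mathcal{D} = \{x : |x| \le 1\}$ and $\rho\in\mathcal{K}$ satisfying $|\rho| = q^{-1}$, the quotient $\mathcal{D}/\rho\mathcal{D}$ has $q$ elements. A function $\phi : G \to \mathbb{C}$ on an Abelian group $G$ (written additively) is nonnegative definite if $\sum_{i,j=1}^n \phi(g_i - g_j) z_i \bar z_j \ge 0$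 for all $n \in \mathbb{N}$, $g_1,\dots,g_n \in G$, and $z_1,\dots,z_n \in \mathbb{C}$. Here this is applied to $G = \mathcal{K}^n$ with addition. *)

(* Defs.v *)
From HB Require Import structures.
From mathcomp Require Import all_boot all_order all_algebra.
From mathcomp Require Import complex.
From mathcomp Require Import all_classical all_reals all_analysis.

Set Implicit Arguments.
Unset Strict Implicit.
Unset Printing Implicit Defensive.

Import Order.TTheory GRing.Theory Num.Theory.
Import numFieldNormedType.Exports.

Local Open Scope classical_set_scope.
Local Open Scope card_scope.
Local Open Scope ring_scope.

HB.mixin Record TopologicalZmodule_isTopologicalField K
    & GRing.Field K & TopologicalZmodule K := {
  mul_continuous_field : continuous (fun x : K * K => x.1 * x.2) ;
  inv_continuous_field :
    forall x : K, x != 0 -> {for x, continuous (fun y : K => y^-1)}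
}.

#[short(type="topologicalFieldType")]
HB.structure Definition TopologicalField :=
  {K of GRing.Field K & TopologicalZmodule K
      & TopologicalZmodule_isTopologicalField K}.

(* [F] carries the topology of its norm; it is instantiated below with the
   real field [R] and the complex field [R[i]]. *)
Definition topological_field_iso (K : topologicalFieldType)
    (F : numFieldType) : Prop :=
  exists f : {rmorphism K -> F},
    [/\ bijective f, continuous (f : K -> F^o)
      & forall U : set K, open U -> open (f @` U : set F^o)].

Record local_field (R : realType) (K : topologicalFieldType) : Prop := {
  local_field_hausdorff : hausdorff_space K ;
  local_field_locally_compact : locally_compact [set: K] ;
  local_field_nondiscrete : ~ (forall x : K, open [set x]) ;
  local_field_not_real : ~ topological_field_iso K R ;
  local_field_not_complex : ~ topological_field_iso K R[i]
}.

Definition value_set (R : realType) (q : nat) : set R :=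
  [set 0] `|` range (fun m : int => (q%:R : R) ^ m).

Definition valuation_ring (R : realType) (K : fieldType) (v : K -> R) : set K :=
  [set x | v x <= 1].

(* The last field says that the quotient of the valuation ring [D] by
   [rho D], realized as the set of the cosets [x + rho D] for [x] in [D], has
   [q] elements. *)
Record normalized_valuation (R : realType) (K : topologicalFieldType)
    (q : nat) (v : K -> R) : Prop := {
  valuation_eq0 : forall x, v x = 0 <-> x = 0 ;
  valuationM : forall x y, v (x * y) = v x * v y ;
  valuationD : forall x y, v (x + y) <= Num.max (v x) (v y) ;
  valuation_nbhs : forall x : K,
    nbhs x = filter_from [set e : R | 0 < e] (fun e => [set y | v (y - x) < e]) ;
  valuation_base :
    exists p c : nat, [/\ prime p, (0 < c)%N & q = (p ^ c)%N] ;
  valuation_range : range v = value_set q ;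
  valuation_quotient : forall rho : K, v rho = q%:R^-1 ->
    [set [set x + rho * d | d in valuation_ring v] | x in valuation_ring v]
      #= `I_q
}.

Definition nonnegative_definite (R : realType) (G : zmodType)
    (f : G -> R[i]) : Prop :=
  forall (n : nat) (g : 'I_n -> G) (z : 'I_n -> R[i]), (0 < n)%N ->
    0 <= \sum_(i < n) \sum_(j < n) f (g i - g j) * z i * (z j)^*%R.

(* Values of [v] are nonnegative, so the default value [0] of the iterated
   maximum is harmless for [n > 0]. *)
Definition radial_function (R : realType) (K : fieldType) (v : K -> R)
    (phi : R -> R) (n : nat) (x : 'rV[K]_n) : R :=
  phi (\big[Num.max/0]_(i < n) v (x 0 i)).

(* Main.v *)
Require Import Defs.
From HB Require Import structures.
From mathcomp Require Import all_boot all_order all_algebra.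
From mathcomp Require Import complex.
From mathcomp Require Import all_classical all_reals all_analysis.
From mathcomp Require Import ring lra.

Import Order.TTheory GRing.Theory Num.Theory.
Import numFieldNormedType.Exports.

Local Open Scope classical_set_scope.
Local Open Scope ring_scope.

(** Write [maxnorm x] for the maximum of the valuations of the coordinates of
[x]; the function in question is [phi (maxnorm x)], and [maxnorm] satisfies
the ultrametric inequality.

If [phi] is nonnegative and nonincreasing, it reverses that inequality: the
matrix [A i j = phi (maxnorm (g i - g j))] is nonnegative, symmetric and
satisfies [min (A i k) (A k j) <= A i j].  Each relation [A i j >= u] with
[u > 0] is therefore symmetric and transitive, its 0/1 matrix is block
diagonal with all-ones blocks (up to null rows), hence positive semidefinite,
and [A] is a nonnegative combination of such matrices, one for each nonzero
value it takes ([ultrametric_matrix_psd]).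

Conversely, let [s <= t] be two values, [v a = s] and [v b = t].  With [e 0],
..., [e n] the standard basis of [K^(1+n)], the points [a *: e i] and
[a *: e i + b *: e 0] for [0 < i] form two clusters of [n] points:
inside a cluster distinct points are at distance [s], and points of different
clusters are at distance [t].  Testing definiteness with the constant weights
[w true] and [w false] on the clusters gives, after division by [n], an
inequality affine in [n] ([two_simplices_ineq]).  Its slope must be
nonnegative, which says that the form
[(w true ^+ 2 + w false ^+ 2) * phi s + 2 * w true * w false * phi t]
is nonnegative.  The weights (1, 0) give [0 <= phi s], and the weights
(1, -1) give [phi t <= phi s]. *)

(** * Positive semidefinite ultrametric matrices *)

(** The quadratic form is the sum over the classes of [e] of the squared
moduli of the sums of [z] over each class; a point
unrelated to itself has a null row and lies outside all classes. *)
Lemma partial_equivalence_psd (C : numClosedFieldType) (I : finType)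
    (e : rel I) (z : I -> C) :
  symmetric e -> transitive e ->
  0 <= \sum_i \sum_j (e i j)%:R * z i * (z j)^*.
Proof.
move=> e_sym e_trans.
(* [r i] labels the class of [i]; the points outside all classes get [None],
   and the factors [e i i] below discard them. *)
pose r i := [pick k | e i k].
have eE i j : e i j =
    (\sum_(c : option I)
       ((r i == c) && e i i) * ((r j == c) && e j j))%N :> nat.
  rewrite (bigD1 (r i)) //= eqxx /= big1 ?addn0; last first.
    by move=> c; rewrite eq_sym => /negbTE ->.
  have [eij|Neij] := boolP (e i j).
    have eji : e j i by rewrite e_sym.
    have -> : r j = r i.
      by apply: eq_pick => k; apply/idP/idP; apply: e_trans.
    by rewrite eqxx (e_trans _ _ _ eij eji) (e_trans _ _ _ eji eij).
  apply/esym/eqP; rewrite muln_eq0 !eqb0 -negb_and.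
  apply: contra Neij => /and3P[eii /eqP rji ejj].
  move: rji; rewrite /r; case: pickP => [k ejk|/(_ j)]; last by rewrite ejj.
  case: pickP => // k' eik' [kk']; move: eik'; rewrite -kk' => eik.
  by rewrite (e_trans k) // e_sym.
pose y c i := ((r i == c) && e i i)%:R * z i.
rewrite [leRHS](_ : _ = \sum_c `|\sum_i y c i| ^+ 2); last first.
  under [RHS]eq_bigr => c _.
    rewrite normCK rmorph_sum mulr_suml.
    under eq_bigr do rewrite mulr_sumr.
    over.
  rewrite [RHS]exchange_big; apply: eq_bigr => i _.
  rewrite [RHS]exchange_big; apply: eq_bigr => j _.
  rewrite eE natr_sum !mulr_suml; apply: eq_bigr => c _.
  by rewrite /y rmorphM /= conjC_nat natrM; ring.
by apply: sumr_ge0 => c _; rewrite exprn_ge0.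
Qed.

(** The layers of [A] are peeled off one at a time: subtracting the least
nonzero entry [a] from all nonzero entries removes [a] times the matrix of the
partial equivalence [A i j != 0].  What remains is the image of [A] under a
nondecreasing map, hence again ultrametric, and has fewer nonzero entries. *)
Lemma ultrametric_matrix_psd (R : rcfType) (I : finType) (A : I -> I -> R)
    (z : I -> R[i]) :
  (forall i j, 0 <= A i j) -> (forall i j, A i j = A j i) ->
  (forall i j k, Num.min (A i k) (A k j) <= A i j) ->
  0 <= \sum_i \sum_j ((A i j)%:C)%C * z i * (z j)^*.
Proof.
have [n] := ubnP #|[pred p : I * I | A p.1 p.2 != 0]|.
elim: n A => // n IHn A ltAn A_ge0 A_sym A_ult.
have [p0 Ap0|A0] := pickP [pred p : I * I | A p.1 p.2 != 0]; last first.
  rewrite big1// => i _; rewrite big1// => j _.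
  by have /negbFE/eqP -> := A0 (i, j); rewrite !mul0r.
have [p Ap pmin] := arg_minP (fun p : I * I => A p.1 p.2) Ap0.
set a := A p.1 p.2 in pmin.
have a_gt0 : 0 < a by rewrite lt_def A_ge0 andbT; apply: Ap.
pose B i j := Num.max (A i j - a) 0.
have BE i j : A i j = B i j + a * (A i j != 0)%:R.
  rewrite /B; have [->|Aij] := eqVneq (A i j) 0.
    by rewrite sub0r mulr0 addr0 max_r // oppr_le0 ltW.
  by rewrite mulr1 max_l ?subrK // subr_ge0; apply: (pmin (i, j)).
have -> : \sum_i \sum_j ((A i j)%:C)%C * z i * (z j)^* =
    \sum_i \sum_j ((B i j)%:C)%C * z i * (z j)^* +
    (a%:C)%C * \sum_i \sum_j (A i j != 0)%:R * z i * (z j)^*.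
  rewrite mulr_sumr -big_split; apply: eq_bigr => i _.
  rewrite mulr_sumr -big_split; apply: eq_bigr => j _.
  by rewrite {1}BE !rmorphD/= rmorphM/= rmorph_nat; ring.
apply: addr_ge0.
  apply: IHn => [|i j|i j|i j k].
  - rewrite ltnS in ltAn; apply: leq_trans ltAn.
    apply/proper_card/properP; split.
      apply/fintype.subsetP => -[i j]; rewrite !inE /= /B; apply: contraNN => /eqP ->.
      by rewrite sub0r max_r // oppr_le0 ltW.
    by exists p; rewrite !inE //= /B subrr maxxx eqxx.
  - by rewrite le_max lexx orbT.
  - by rewrite /B A_sym.
  - have := A_ult i j k; rewrite !ge_min => /orP[] le_A; apply/orP;
      [left|right]; by rewrite ge_max !le_max lexx orbT lerB.
apply: mulr_ge0; first by rewrite lecR ltW.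
apply: (@partial_equivalence_psd _ _ (fun i j => A i j != 0)).
  by move=> i j; rewrite A_sym.
move=> k i j; have A_gt0 x y : (A x y != 0) = (0 < A x y).
  by rewrite lt_def A_ge0 andbT.
rewrite !A_gt0 => Aik Akj; apply: lt_le_trans (A_ult i j k).
by rewrite lt_min Aik.
Qed.

Lemma nonnegative_definite_finType (R : realType) (G : zmodType)
    (f : G -> R[i]) (I : finType) (g : I -> G) (z : I -> R[i]) :
  nonnegative_definite f -> (0 < #|I|)%N ->
  0 <= \sum_i \sum_j f (g i - g j) * z i * (z j)^*.
Proof.
move=> f_psd I_gt0; have := f_psd _ (g \o enum_val) (z \o enum_val) I_gt0.
congr (0 <= _); rewrite [RHS](reindex _ (onW_bij _ (enum_val_bij I))) /=.
apply: eq_bigr => i _.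
by rewrite [RHS](reindex _ (onW_bij _ (enum_val_bij I))).
Qed.

(** * From many points to a limit inequality *)

Lemma affine_ge0_slope_ge0 (R : archiRealFieldType) (c d : R) :
  (forall n, (0 < n)%N -> 0 <= c + n%:R * d) -> 0 <= d.
Proof.
move=> cd_ge0; rewrite leNgt; apply/negP => d_lt0.
have := cd_ge0 (Num.truncn (`|c| / - d)).+1 isT; apply/negP; rewrite -ltNge.
have : `|c| / - d < (Num.truncn (`|c| / - d)).+1%:R by apply: truncnS_gt.
rewrite ltr_pdivrMr ?oppr_gt0 // mulrN => c_lt.
by have := ler_norm c; lra.
Qed.

(** * The maximum norm and its two-cluster configurations *)

Section Valuation.
Context {R : realType} {K : topologicalFieldType} {q : nat} {v : K -> R}.
Context (v_valuation : normalized_valuation q v).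

Definition maxnorm {n} (x : 'rV[K]_n) : R := \big[Num.max/0]_(i < n) v (x 0 i).

Lemma valuation0 : v 0 = 0.
Proof. exact/(valuation_eq0 v_valuation). Qed.

Lemma valuation_in_value_set x : value_set q (v x).
Proof. by rewrite -(valuation_range v_valuation); exists x. Qed.

Lemma value_set_ge0 (s : R) : value_set q s -> 0 <= s.
Proof. by case=> [->//|[m _ <-]]; apply: exprz_ge0. Qed.

Lemma valuation_ge0 x : 0 <= v x.
Proof. exact/value_set_ge0/valuation_in_value_set. Qed.

Lemma valuationN x : v (- x) = v x.
Proof.
have v1 : v 1 = 1.
  have v1_neq0 : v 1 != 0.
    by apply/eqP => /(valuation_eq0 v_valuation)/eqP; rewrite oner_eq0.
  by apply: (mulfI v1_neq0); rewrite -(valuationM v_valuation) !mulr1.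
have vN1 : v (-1) = 1.
  apply/eqP; rewrite -(@pexpr_eq1 _ _ 2) ?valuation_ge0 //.
  by rewrite expr2 -(valuationM v_valuation) mulrNN mulr1 v1.
by rewrite -mulN1r (valuationM v_valuation) vN1 mul1r.
Qed.

Lemma maxnorm_in_value_set n (x : 'rV[K]_n) : value_set q (maxnorm x).
Proof.
apply: (big_ind (@value_set R q)) => [|s t s_val t_val|i _]; first by left.
  by rewrite maxEle; case: ifP.
exact: valuation_in_value_set.
Qed.

Lemma maxnormN n (x : 'rV[K]_n) : maxnorm (- x) = maxnorm x.
Proof. by apply: eq_bigr => i _; rewrite mxE valuationN. Qed.

Lemma maxnormD n (x y : 'rV[K]_n) :
  maxnorm (x + y) <= Num.max (maxnorm x) (maxnorm y).
Proof.
apply: bigmax_le => [|i _].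
  by rewrite le_max value_set_ge0 //; apply: maxnorm_in_value_set.
rewrite mxE; apply: le_trans (valuationD v_valuation _ _) _.
by rewrite ge_max !le_max !le_bigmax ?orbT.
Qed.

(** A nonincreasing [phi] turns the ultrametric inequality for [maxnorm] into
the one required by [ultrametric_matrix_psd]. *)
Lemma radial_nonnegative_definite (phi : R -> R) n :
  (forall s, value_set q s -> 0 <= phi s) ->
  (forall s t, value_set q s -> value_set q t -> s <= t -> phi t <= phi s) ->
  nonnegative_definite
    (fun x : 'rV[K]_n => ((radial_function v phi x)%:C)%C).
Proof.
move=> phi_ge0 phi_anti m g z _.
apply: (@ultrametric_matrix_psd _ _
  (fun i j => radial_function v phi (g i - g j))) => [i j|i j|i j k].
- exact/phi_ge0/maxnorm_in_value_set.
- by congr phi; rewrite -opprB; apply: maxnormN.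
- have := maxnormD _ (g i - g k) (g k - g j); rewrite addrA subrK.
  rewrite le_max ge_min => /orP[] le_norm; apply/orP; [left|right];
    by apply: phi_anti le_norm; apply: maxnorm_in_value_set.
Qed.

(** The first coordinate [b *+ c] selects the cluster, the other coordinates
place a vertex of a regular simplex of side [v a].  Since [v a <= v b], the
first coordinate alone decides the distance between different clusters. *)
Lemma maxnorm_two_simplices n (a b : K) (c d : bool) (i j : 'I_n) :
  v a <= v b ->
  maxnorm (row_mx (b *+ c)%:M (a *: delta_mx 0 i) -
           row_mx (b *+ d)%:M (a *: delta_mx 0 j) : 'rV_(1 + n)) =
  if c == d then if i == j then 0 else v a else v b.
Proof.
move=> le_ab; rewrite opp_row_mx add_row_mx /maxnorm big_ord_recl /=.
under eq_bigr do rewrite -rshift1.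
rewrite -[ord0](lshift0 n 0).
have -> : \big[Num.max/0]_(k < n)
    v (row_mx ((b *+ c)%:M - (b *+ d)%:M) (a *: delta_mx 0 i - a *: delta_mx 0 j)
         0 (rshift 1 k)) = if i == j then 0 else v a.
  under eq_bigr do rewrite row_mxEr !mxE eqxx /=.
  have [<-|neq_ij] := eqVneq i j.
    under eq_bigr do rewrite subrr valuation0.
    by elim/big_ind: _ => // x y -> ->; rewrite maxxx.
  apply/le_anti/andP; split.
    apply: bigmax_le => [|k _]; first by rewrite valuation_ge0.
    have [->|_] := eqVneq k i.
      by rewrite (negbTE neq_ij) mulr1 mulr0 subr0.
    rewrite mulr0 sub0r valuationN.
    by case: (k == j); rewrite ?mulr1 // mulr0 valuation0 valuation_ge0.
  have := le_bigmax (0 : R) (fun k => v (a * (k == i)%:R - a * (k == j)%:R)) i.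
  by rewrite /= eqxx (negbTE neq_ij) mulr1 mulr0 subr0.
rewrite row_mxEl !mxE eqxx !mulr1n.
case: c d => [] [] /=;
  rewrite ?subrr ?subr0 ?sub0r ?valuationN ?valuation0 ?mulr1n;
  case: ifP => _; by rewrite ?maxxx ?(max_r (valuation_ge0 _))
    ?(max_l (valuation_ge0 _)) ?(max_l le_ab).
Qed.

(** Each of the [2 * n] points sees itself, [n.-1] points at distance [v a] and
[n] points at distance [v b]; the common factor [n] is divided out. *)
Lemma two_simplices_ineq (phi : R -> R) n (a b : K) (w : bool -> R) :
  nonnegative_definite
    (fun x : 'rV[K]_(1 + n) => ((radial_function v phi x)%:C)%C) ->
  (0 < n)%N -> v a <= v b ->
  0 <= (w true ^+ 2 + w false ^+ 2) * (phi 0 + (n.-1)%:R * phi (v a)) +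
       2 * w true * w false * n%:R * phi (v b).
Proof.
move=> phi_psd n_gt0 le_ab.
pose g (p : bool * 'I_n) : 'rV[K]_(1 + n) :=
  row_mx (b *+ p.1)%:M (a *: delta_mx 0 p.2).
have := @nonnegative_definite_finType _ _ _ _ g (fun p => ((w p.1)%:C)%C) phi_psd.
rewrite card_prod card_bool card_ord muln_gt0 n_gt0 => /(_ isT).
have -> : \sum_p \sum_p' ((radial_function v phi (g p - g p'))%:C)%C *
      ((w p.1)%:C)%C * (((w p'.1)%:C)%C)^* =
    ((\sum_p \sum_p' radial_function v phi (g p - g p') * w p.1 * w p'.1)%:C)%C.
  rewrite rmorph_sum; apply: eq_bigr => p _; rewrite rmorph_sum.
  by apply: eq_bigr => p' _; rewrite !rmorphM /= conj_Creal // complex_real.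
rewrite lecR.
rewrite (_ : \sum_p \sum_p' _ = n%:R *
  ((w true ^+ 2 + w false ^+ 2) * (phi 0 + (n.-1)%:R * phi (v a)) +
   2 * w true * w false * n%:R * phi (v b))).
  by rewrite pmulr_rge0 ?ltr0n.
rewrite -(pair_bigA _ (fun c i => \sum_p'
  radial_function v phi (g (c, i) - g p') * w c * w p'.1)) /=.
have radial_g c d i j : radial_function v phi (g (c, i) - g (d, j)) =
    phi (if c == d then if i == j then 0 else v a else v b).
  by congr phi; apply: maxnorm_two_simplices.
have row_sum c i : \sum_p' radial_function v phi (g (c, i) - g p') * w c * w p'.1 =
    w c ^+ 2 * (phi 0 + (n.-1)%:R * phi (v a)) +
    w c * w (~~ c) * n%:R * phi (v b).
  rewrite -(pair_bigA _ (fun d j =>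
    radial_function v phi (g (c, i) - g (d, j)) * w c * w d)) /=.
  have -> (F : bool -> R) : \sum_d F d = F c + F (~~ c).
    by rewrite big_bool; case: (c); rewrite //= addrC.
  congr (_ + _).
    under eq_bigr do rewrite radial_g eqxx.
    rewrite (bigD1 i) //= eqxx.
    under eq_bigr => j do rewrite eq_sym => /negbTE ->.
    by rewrite sumr_const cardC1 card_ord -mulr_natl; ring.
  have neq_c : (c == ~~ c) = false by case: (c).
  under eq_bigr do rewrite radial_g neq_c.
  by rewrite sumr_const card_ord -mulr_natl; ring.
under eq_bigr do under eq_bigr do rewrite row_sum.
under eq_bigr do rewrite sumr_const card_ord -mulr_natl.
by rewrite big_bool /=; ring.
Qed.

End Valuation.

Theorem theorem4p1 (R : realType) (K : topologicalFieldType) (q : nat)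
    (v : K -> R) (phi : R -> R)
    (K_local : local_field R K)
    (v_valuation : normalized_valuation q v)
    (phi_lim : (fun m : nat => phi ((q%:R : R) ^ (- m%:Z))) @ \oo --> phi 0)
    (phi0 : phi 0 = 1) :
  (forall n : nat, (0 < n)%N ->
     nonnegative_definite
       (fun x : 'rV[K]_n => ((radial_function v phi x)%:C)%C))
  <->
  (forall s : R, value_set q s -> 0 <= phi s) /\
  (forall s t : R, value_set q s -> value_set q t -> s <= t -> phi t <= phi s).
Proof.
split=> [phi_psd|[phi_ge0 phi_anti] n _]; last first.
  exact: (radial_nonnegative_definite v_valuation _ _ phi_ge0 phi_anti).
have value_setP s : value_set q s -> exists a, v a = s.
  by rewrite -(valuation_range v_valuation) => -[a _ <-]; exists a.
(* The slopes in [n] of the inequalities of [two_simplices_ineq]. *)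
have ineq a b w : v a <= v b ->
    0 <= (w true ^+ 2 + w false ^+ 2) * phi (v a) +
         2 * w true * w false * phi (v b).
  move=> le_ab.
  apply: (@affine_ge0_slope_ge0 R
    ((w true ^+ 2 + w false ^+ 2) * (1 - phi (v a)))) => -[//|n] _.
  have := two_simplices_ineq v_valuation _ _ _ _ w (phi_psd n.+2 isT) isT le_ab.
  by rewrite phi0 /= -[n.+1%:R]natr1; congr (0 <= _); ring.
split=> [s /value_setP[a <-]|s t /value_setP[a <-] /value_setP[b <-] le_ab].
  by have := ineq a a (fun c => c%:R) (lexx _) => /=; lra.
by have := ineq a b (fun c => (-1) ^+ c) le_ab => /=; lra.
Qed.
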